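(* Let $f:\mathbb{R}^n\to\mathbb{R}$ be convex and differentiable, with nonempty set of minimizers $\mathcal{X}^\star$ and minimal value $f^\star$. Let $\gamma\in(0,2)$ and $x^0\in\mathbb{R}^n$, and set $$\mathcal{K}=\bigcup_{x^\star\in\mathcal{X}^\star}\mathbb{B}(x^\star,\|x^0-x^\star\|),$$ where $\mathbb{B}(c,R)$ is the closed Euclidean ball of center $c$ and radius $R$. Suppose that $f$ is $(\nu,L_\nu)$-Hölder smooth (with $\nu\in(0,1]$, $L_\nu>0$) and satisfies the $(r,\rho_r)$-Hölder growth condition on $\mathcal{K}$ (with $r\ge1$, $\rho_r>0$). Then for every even integer $K\ge 1$ the iterates generated by $\gamma$-PolyakGD from $x^0$ satisfy: (i) if $r=\nu+1$, $$\min_{1\le k\le K} f(x^k)-f^\star\le\left(1-\frac{\gamma(2-\gamma)\,\nu^{\frac{2\nu}{\nu+1}}\rho_r^{\frac{2}{\nu+1}}}{(\nu+1)^{\frac{2\nu}{\nu+1}}L_\nu^{\frac{2}{\nu+1}}}\right)^{\frac K2}\ \sup_{x\in\mathcal{K}}\|\nabla f(x)\|\cdot\operatorname{dist}(x^0,\mathcal{X}^\star);$$ (ii) if $r>\nu+1$, $$\min_{1\le k\le K} f(x^k)-f^\star\le\frac{(r-\nu-1)^{\frac{(\nu+1)^2}{2(\nu+1-r)}}\,(\gamma(2-\gamma))^{\frac{r(\nu+1)}{2(\nu+1-r)}}\,\nu^{\frac{\nu r}{\nu+1-r}}}{2^{\frac{r(\nu+1)}{2(\nu+1-r)}}\,(\nu+1)^{\frac{(\nu+1)^2+2\nu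 r}{2(\nu+1-r)}}}\cdot\frac{L_\nu^{\frac{r}{r-\nu-1}}}{\rho_r^{\frac{\nu+1}{r-\nu-1}}\,K^{\frac{r(\nu+1)}{2(r-\nu-1)}}}.$$
   Context: For a differentiable convex function $f$ with minimal value $f^\star$ and a parameter $\gamma>0$, $\gamma$-PolyakGD is the iteration $x^{k+1}=x^k-\gamma\,\alpha_k\nabla f(x^k)$ with Polyak stepsize $\alpha_k=\dfrac{f(x^k)-f^\star}{\|\nabla f(x^k)\|^2}$, $k=0,1,\dots$ ($\|\cdot\|$ is the Euclidean norm; if $\nabla f(x^k)=0$ the iteration stays at $x^k$). $f$ is $(\nu,L_\nu)$-Hölder smooth if $\|\nabla f(x)-\nabla f(y)\|\le L_\nu\|x-y\|^\nu$ for all $x,y\in\mathbb{R}^n$. $f$ satisfies the $(r,\rho_r)$-Hölder growth condition on a nonempty set $\mathcal{K}\subseteq\mathbb{R}^n$ if $f(x)-f^\star\ge\rho_r\operatorname{dist}(x,\mathcal{X}^\star)^r$ for all $x\in\mathcal{K}$, where $\operatorname{dist}(x,\mathcal{X}^\star)=\inf_{x^\star\in\mathcal{X}^\star}\|x-x^\star\|$. *)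

(* Defs.v *)
From HB Require Import structures.
From mathcomp Require Import all_boot all_order all_algebra.
From mathcomp Require Import all_classical all_reals all_analysis.

Set Implicit Arguments.
Unset Strict Implicit.
Unset Printing Implicit Defensive.

Import Order.TTheory GRing.Theory Num.Theory.
Import numFieldNormedType.Exports.

Local Open Scope classical_set_scope.
Local Open Scope ring_scope.

(* The norm `|x| that the library puts on 'rV[R]_n is the sup norm, hence an
   explicit Euclidean norm. The two norms are equivalent, so the library's
   [differentiable] is the usual differentiability on R^n. *)
Definition enorm (R : realType) (n : nat) (x : 'rV[R]_n) : R :=
  Num.sqrt (\sum_(i < n) x 0 i ^+ 2).

Definition eball (R : realType) (n : nat) (c : 'rV[R]_n) (rad : R) :
  set 'rV[R]_n := [set x | enorm (x - c) <= rad].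

Definition grad (R : realType) (n : nat) (f : 'rV[R]_n -> R) (x : 'rV[R]_n) :
  'rV[R]_n := \row_(i < n) 'D_(delta_mx 0 i) f x.

Definition minimizers (R : realType) (n : nat) (f : 'rV[R]_n -> R) :
  set 'rV[R]_n := [set x | forall y, f x <= f y].

(* Attained, hence the minimum of f, as soon as f has a minimizer. *)
Definition min_value (R : realType) (n : nat) (f : 'rV[R]_n -> R) : R :=
  inf (range f).

Definition dist_to (R : realType) (n : nat) (x : 'rV[R]_n) (A : set 'rV[R]_n) : R :=
  inf [set enorm (x - y) | y in A].

Definition polyak_stepsize (R : realType) (n : nat) (f : 'rV[R]_n -> R)
    (x : 'rV[R]_n) : R :=
  (f x - min_value f) / enorm (grad f x) ^+ 2.

Definition polyak_step (R : realType) (n : nat) (f : 'rV[R]_n -> R) (gamma : R)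
    (x : 'rV[R]_n) : 'rV[R]_n :=
  if grad f x == 0 then x
  else x - (gamma * polyak_stepsize f x) *: grad f x.

Definition polyakGD (R : realType) (n : nat) (f : 'rV[R]_n -> R) (gamma : R)
    (x0 : 'rV[R]_n) (k : nat) : 'rV[R]_n :=
  iter k (polyak_step f gamma) x0.

Definition holder_smooth (R : realType) (n : nat) (f : 'rV[R]_n -> R)
    (nu L : R) : Prop :=
  forall x y, enorm (grad f x - grad f y) <= L * enorm (x - y) `^ nu.

Definition holder_growth (R : realType) (n : nat) (f : 'rV[R]_n -> R)
    (r rho : R) (A : set 'rV[R]_n) : Prop :=
  forall x, A x -> rho * dist_to x (minimizers f) `^ r <= f x - min_value f.

Definition ball_union (R : realType) (n : nat) (f : 'rV[R]_n -> R)
    (x0 : 'rV[R]_n) : set 'rV[R]_n :=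
  \bigcup_(xs in minimizers f) eball xs (enorm (x0 - xs)).

(* Meaningful for 1 <= K: the default value of the big minimum is then one of
   the terms. *)
Definition best_value (R : realType) (n : nat) (f : 'rV[R]_n -> R)
    (x : nat -> 'rV[R]_n) (K : nat) : R :=
  \big[Num.min/f (x 1%N)]_(1 <= k < K.+1) f (x k).

(* The supremum of the gradient norm over A is +oo when the gradient is
   not bounded on A (this can happen for A = ball_union f x0, if the
   set of minimizers of f is unbounded), hence the extended reals. *)
Definition grad_sup (R : realType) (n : nat) (f : 'rV[R]_n -> R)
    (A : set 'rV[R]_n) : \bar R :=
  ereal_sup [set (enorm (grad f x))%:E | x in A].

(* Main.v *)
Require Import Defs.
From HB Require Import structures.
From mathcomp Require Import all_boot all_order all_algebra.
From mathcomp Require Import all_classical all_reals all_analysis.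
From mathcomp Require Import lra ring.
Import Order.TTheory GRing.Theory Num.Theory.
Import numFieldNormedType.Exports.
Local Open Scope classical_set_scope.
Local Open Scope ring_scope.
Set Implicit Arguments.
Unset Strict Implicit.
Unset Printing Implicit Defensive.

(** Write [d k := f (x k) - min_value f] and [D k] for the distance from [x k] to
    the minimizers. Minimizing the Hölder upper model of [f] at [x] gives
    [d ^ 2 / |grad f x| ^ 2 >= c * d ^ (2 / (nu + 1))] with
    [c = polyak_rate nu L], so that the Polyak step
    satisfies [D (k+1) ^ 2 + A * d k ^ (2 / (nu + 1)) <= D k ^ 2] with
    [A = gamma * (2 - gamma) * c]. The growth condition turns this into
    [D (k+1) ^ 2 <= D k ^ 2 - B * (D k ^ 2) ^ (r / (nu + 1))]. If [r = nu + 1],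
    this is geometric decay of [D], and [d K <= |grad f (x K)| * D K]. If
    [r > nu + 1], then [D k ^ 2] is at most of order
    [k ^ (- (nu + 1) / (r - nu - 1))], and summing the first inequality over the second half [K/2 <= k < K] of the
    iterations bounds the smallest [d k]. *)

(** * Euclidean inner product and norm *)

Section Euclid.
Variables (R : realType) (n : nat).
Implicit Types u v w : 'rV[R]_n.

Definition edot u v : R := \sum_(i < n) u 0 i * v 0 i.

Lemma edotC u v : edot u v = edot v u.
Proof. by apply: eq_bigr => i _; rewrite mulrC. Qed.

Lemma edotDl u v w : edot (u + v) w = edot u w + edot v w.
Proof. by rewrite -big_split; apply: eq_bigr => i _; rewrite mxE mulrDl. Qed.

Lemma edotZl a u v : edot (a *: u) v = a * edot u v.
Proof. by rewrite mulr_sumr; apply: eq_bigr => i _; rewrite mxE mulrA. Qed.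

Lemma edotNl u v : edot (- u) v = - edot u v.
Proof. by rewrite -scaleN1r edotZl mulN1r. Qed.

Lemma enorm_ge0 u : 0 <= enorm u.
Proof. exact: sqrtr_ge0. Qed.

Lemma enorm_sqr u : enorm u ^+ 2 = edot u u.
Proof.
rewrite sqr_sqrtr; first by apply: eq_bigr => i _; rewrite expr2.
by apply: sumr_ge0 => i _; exact: sqr_ge0.
Qed.

Lemma enorm_eq0 u : (enorm u == 0) = (u == 0).
Proof.
apply/idP/eqP => [|->]; last first.
  by rewrite -sqrf_eq0 enorm_sqr /edot big1 // => i _; rewrite mxE mul0r.
rewrite -sqrf_eq0 enorm_sqr /edot psumr_eq0 => [/allP u0|i _]; last first.
  by rewrite -expr2 sqr_ge0.
apply/rowP => i; apply/eqP.
by have := u0 i (mem_index_enum i); rewrite mulf_eq0 orbb mxE.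
Qed.

Lemma enormZ a u : enorm (a *: u) = `|a| * enorm u.
Proof.
apply/eqP; rewrite -(@eqrXn2 _ 2) ?mulr_ge0 ?normr_ge0 ?enorm_ge0 //.
rewrite exprMn !enorm_sqr edotZl edotC edotZl real_normK ?num_real //.
by rewrite mulrA expr2.
Qed.

Lemma enormB_sqr u v :
  enorm (u - v) ^+ 2 = enorm u ^+ 2 - 2 * edot u v + enorm v ^+ 2.
Proof.
rewrite !enorm_sqr edotDl edotNl !(edotC _ (u - v)) !edotDl !edotNl (edotC v u).
ring.
Qed.

(** Cauchy-Schwarz: for nonzero vectors, the squared norm of [enorm v *: u - enorm u *: v] expands
    to [2 * (enorm u * enorm v)] times the difference of the two sides. *)
Lemma edot_le u v : edot u v <= enorm u * enorm v.
Proof.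
have [->|u0] := eqVneq u 0.
  rewrite /edot big1 ?mulr_ge0 ?enorm_ge0 // => i _.
  by rewrite mxE mul0r.
have [->|v0] := eqVneq v 0.
  rewrite /edot big1 ?mulr_ge0 ?enorm_ge0 // => i _.
  by rewrite mxE mulr0.
have uv : 0 < enorm u * enorm v.
  by rewrite mulr_gt0 // lt_neqAle eq_sym enorm_eq0 ?u0 ?v0 enorm_ge0.
have := sqr_ge0 (enorm (enorm v *: u - enorm u *: v)).
rewrite enormB_sqr !enormZ edotZl edotC edotZl edotC.
rewrite !ger0_norm ?enorm_ge0 // => h.
have : 0 <= 2 * (enorm u * enorm v) * (enorm u * enorm v - edot u v) by nra.
by rewrite pmulr_rge0 ?subr_ge0 // mulr_gt0.
Qed.

End Euclid.

(** * First-order inequalities for convex and for Hölder smooth functions *)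

Section Gradient.
Variables (R : realType) (n : nat) (f : 'rV[R]_n -> R).
Hypothesis f_diff : forall x, differentiable f x.
Implicit Types x y d : 'rV[R]_n.

Lemma derive_grad x d : 'D_d f x = edot (grad f x) d.
Proof.
rewrite deriveE // {1}(row_sum_delta d) linear_sum edotC.
by apply: eq_bigr => i _; rewrite linearZ /= mxE deriveE.
Qed.

Lemma is_derive_line x d (t : R) :
  is_derive t 1 (fun s : R => f (x + s *: d)) (edot (grad f (x + t *: d)) d).
Proof.
have E : (fun h : R => h^-1 *: (f (x + (h *: 1 + t) *: d) - f (x + t *: d))) =
         (fun h : R => h^-1 *: (f (h *: d + (x + t *: d)) - f (x + t *: d))).
  apply/funext => h; congr (_ *: (f _ - _)).
  by rewrite -[h *: 1]/(h * 1) mulr1 scalerDl addrCA.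
rewrite -derive_grad; apply: DeriveDef.
  by rewrite /derivable /comp /= E; exact: diff_derivable.
by rewrite /derive /comp /= E.
Qed.

(** Convexity bounds the difference quotient at [x] in direction [y - x] by [f y - f x] for every
    step [h] in ]0, 1]; the bound survives the limit from the right. *)
Lemma convex_grad_le x y : convex_function setT f ->
  f x + edot (grad f x) (y - x) <= f y.
Proof.
move=> f_convex; rewrite -lerBrDl -derive_grad.
have /cvg_ex[l fl] : derivable f x (y - x) by exact: diff_derivable.
rewrite /derive (cvg_lim _ fl) //.
apply: (cvgr_to_le (cvg_dnbhs_at_right fl)).
near=> h.
have h0 : 0 < h by [].
have h1 : 0 <= h <= 1 by rewrite ltW //=; near: h; exact: nbhs_right_le.
pose t : {i01 R} := Itv01 (andP h1).1 (andP h1).2.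
have := f_convex t y x; rewrite !inE => /(_ I I).
have -> : conv t (y : convex_lmodType 'rV[R]_n) x = h *: (y - x) + x.
  by rewrite /conv /= scalerBl scale1r scalerBr addrA addrAC.
have -> : conv t (f y : R^o) (f x) = h * f y + (1 - h) * f x by [].
by move=> fle; rewrite -[_ *: _]/(_ * _) ler_pdivrMl //=; lra.
Unshelve. all: by end_near. Qed.

(** The mean value theorem replaces the usual integral: [phi] is the error of the model along the
    segment from [x] to [y], and Cauchy-Schwarz with Hölder smoothness makes its derivative
    nonpositive on ]0, 1[. *)
Lemma holder_descent nu L x y : 0 < nu -> holder_smooth f nu L ->
  f y <= f x + edot (grad f x) (y - x) + L / (nu + 1) * enorm (y - x) `^ (nu + 1).
Proof.
move=> nu0 fL; set d := y - x.
have nu1 : 0 < nu + 1 by rewrite addr_gt0.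
pose c := L / (nu + 1) * enorm d `^ (nu + 1).
pose phi (t : R) := f (x + t *: d) - t * edot (grad f x) d - c * t `^ (nu + 1).
pose dphi (t : R) := edot (grad f (x + t *: d)) d - edot (grad f x) d
   - c * ((nu + 1) * t `^ (nu + 1 - 1)).
have dphiP (t : R) : 0 < t -> is_derive t 1 phi (dphi t).
  move=> t0.
  have ? := is_derive_line x d t.
  have ? := is_derive1_powR (nu + 1) t0.
  by apply: is_derive_eq; rewrite /dphi /GRing.scale /=; ring.
suff : phi 1 <= phi 0.
  rewrite /phi powR1 powR0 ?gt_eqF // scale1r scale0r addr0 mulr1 mulr0.
  by rewrite {1}/d addrCA subrr addr0 /c; lra.
have phi_cont (t : R) : 0 < t -> {for t, continuous phi}.
  move=> t0; apply: differentiable_continuous; apply/derivable1_diffP.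
  by case: (dphiP _ t0).
have [||t] := @MVT R phi dphi 0 1 ltr01.
- by move=> t; rewrite in_itv /= => /andP[t0 _]; exact: dphiP.
- apply/continuous_within_itvP => //; split.
  + by move=> t; rewrite in_itv /= => /andP[t0 _]; exact: phi_cont.
  (* [dphiP] covers only [0 < t], because of the real power, so right continuity at 0 is shown term
     by term. *)
  + have f0 : f (x + t *: d) @[t --> 0^'+] --> f (x + (0 : R) *: d).
      apply: cvg_at_right_filter.
      have : differentiable (fun s : R => f (x + s *: d)) 0.
        by apply/derivable1_diffP; case: (is_derive_line x d 0).
      exact: differentiable_continuous.
    rewrite /phi powR0 ?gt_eqF //; apply: cvgB.
      apply: cvgB => //; apply: cvgMl.
      by apply: cvg_at_right_filter; exact: cvg_id.
    by apply: cvgMr; exact: powR_cvg0.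
  + by apply: cvg_at_left_filter; exact: phi_cont.
rewrite in_itv /= => /andP[t0 t1]; rewrite subr0 mulr1 => e.
rewrite -subr_le0 e /dphi subr_le0 -edotNl -edotDl.
apply: (le_trans (edot_le _ _)).
apply: (le_trans (ler_wpM2r (enorm_ge0 _) (fL _ _))).
rewrite addrAC subrr add0r enormZ (gtr0_norm t0) powRM ?enorm_ge0 ?(ltW t0) //.
rewrite addrK /c powRD; last by rewrite (gt_eqF nu1).
rewrite powRr1 ?enorm_ge0 //.
suff -> : L * (t `^ nu * enorm d `^ nu) * enorm d =
    L / (nu + 1) * (enorm d `^ nu * enorm d) * ((nu + 1) * t `^ nu) by [].
by field; rewrite gt_eqF.
Qed.

End Gradient.

(** * Minimal value and distance to a set *)

Lemma min_valueE (R : realType) (n : nat) (f : 'rV[R]_n -> R) xs :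
  minimizers f xs -> min_value f = f xs.
Proof.
move=> fxs; apply/eqP; rewrite eq_le; apply/andP; split.
  by apply: ge_inf; [exists (f xs) => _ [y _ <-] | exists xs].
by apply: lb_le_inf => [|_ [y _ <-]]; [exists (f xs), xs | exact: fxs].
Qed.

Section DistTo.
Variables (R : realType) (n : nat) (x : 'rV[R]_n) (A : set 'rV[R]_n).

Lemma dist_to_le y : A y -> dist_to x A <= enorm (x - y).
Proof.
move=> Ay; apply: ge_inf; last by exists y.
by exists 0 => _ [z _ <-]; exact: enorm_ge0.
Qed.

Lemma le_dist_to a : A !=set0 -> (forall y, A y -> a <= enorm (x - y)) ->
  a <= dist_to x A.
Proof.
move=> [y Ay] aA; apply: lb_le_inf; first by exists (enorm (x - y)), y.
by move=> _ [z Az <-]; exact: aA.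
Qed.

Lemma dist_to_ge0 : A !=set0 -> 0 <= dist_to x A.
Proof. by move=> A0; apply: le_dist_to => // y _; exact: enorm_ge0. Qed.

End DistTo.

(** * Lower bound on the gap in terms of the gradient *)

Definition polyak_rate (R : realType) (nu L : R) : R :=
  nu `^ (2 * nu / (nu + 1)) /
  ((nu + 1) `^ (2 * nu / (nu + 1)) * L `^ (2 / (nu + 1))).

Lemma polyak_rate_gt0 (R : realType) (nu L : R) :
  0 < nu -> 0 < L -> 0 < polyak_rate nu L.
Proof. by move=> nu0 L0; rewrite divr_gt0 ?mulr_gt0 ?powR_gt0 ?addr_gt0. Qed.

Section HolderSmooth.
Variables (R : realType) (n : nat) (f : 'rV[R]_n -> R) (nu L : R).
Hypothesis f_diff : forall x, differentiable f x.
Hypothesis f_min : minimizers f !=set0.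
Hypotheses (nu_gt0 : 0 < nu) (L_gt0 : 0 < L).
Hypothesis f_smooth : holder_smooth f nu L.
Implicit Types x y : 'rV[R]_n.

Lemma min_value_le x : min_value f <= f x.
Proof. by case: f_min => xs fxs; rewrite (min_valueE fxs). Qed.

(* The minimum over [y] of the Hölder upper model of [f] at [x]. *)
Lemma holder_grad_gap x :
  nu / (nu + 1) * ((enorm (grad f x) / L) `^ nu^-1 * enorm (grad f x))
  <= f x - min_value f.
Proof.
set g := enorm (grad f x).
have [g0|g0] := eqVneq g 0; first by rewrite g0 !mulr0 subr_ge0 min_value_le.
have {}g0 : 0 < g by rewrite lt_neqAle eq_sym g0 enorm_ge0.
have nu1 : 0 < nu + 1 by rewrite addr_gt0.
(* The step length [s] along the normalized negative gradient solves [L * s]^ nu =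
   g[, the stationarity condition of]- s * g + L / (nu + 1) * s [^ (nu + 1)]. *)
set s := (g / L) `^ nu^-1.
have s0 : 0 < s by rewrite powR_gt0 // divr_gt0.
pose y := x - (s / g) *: grad f x.
have yx : y - x = - (s / g) *: grad f x by rewrite addrAC subrr add0r scaleNr.
have := holder_descent f_diff x y nu_gt0 f_smooth.
rewrite yx edotC edotZl -enorm_sqr enormZ normrN gtr0_norm ?divr_gt0 // -/g.
rewrite divfK ?gt_eqF // powRD; last by rewrite (gt_eqF nu1).
rewrite powRr1 ?(ltW s0) // -powRrM mulVf ?gt_eqF //.
rewrite powRr1 ?(ltW (divr_gt0 _ _)) //.
have -> : f x + - (s / g) * g ^+ 2 + L / (nu + 1) * (g / L * s) =
          f x - nu / (nu + 1) * (s * g).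
  by field; rewrite !gt_eqF.
have := min_value_le y.
lra.
Qed.

(** This is [holder_grad_gap] raised to the power [2 * nu / (nu + 1)], which gives the gradient norm
    the exponent 2 and turns the constant into [polyak_rate nu L]; the missing power of the gap is
    then multiplied in. *)
Lemma polyak_rate_le x :
  polyak_rate nu L * (f x - min_value f) `^ (2 / (nu + 1))
    * enorm (grad f x) ^+ 2 <= (f x - min_value f) ^+ 2.
Proof.
set d := f x - min_value f.
have nu1 : 0 < nu + 1 by rewrite addr_gt0.
have d0 : 0 <= d by rewrite subr_ge0 min_value_le.
have g0 : 0 <= enorm (grad f x) := enorm_ge0 _.
have L0 := ltW L_gt0; have nu0 := ltW nu_gt0; have nu10 := ltW nu1.
have e0 : 0 <= 2 * nu / (nu + 1) by rewrite divr_ge0 ?mulr_ge0.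
have -> : d ^+ 2 = d `^ (2 / (nu + 1)) * d `^ (2 * nu / (nu + 1)).
  rewrite -powR_mulrn // -powRD; first by congr (_ `^ _); field; rewrite gt_eqF.
  by rewrite gt_eqF // addr_gt0 ?divr_gt0 ?mulr_gt0.
rewrite mulrAC mulrC ler_wpM2l ?powR_ge0 //.
have := holder_grad_gap x; rewrite -/d; set g := enorm _ in g0 *.
move=> /(ge0_ler_powR e0); rewrite !nnegrE => /(_ _ d0) h.
apply: le_trans (h _); last first.
  by rewrite !mulr_ge0 ?powR_ge0 ?invr_ge0.
have [->|gn0] := eqVneq g 0; first by rewrite expr0n mulr0 powR_ge0.
have gp : 0 < g by rewrite lt_neqAle eq_sym gn0.
have sp : 0 < (g / L) `^ nu^-1 by rewrite powR_gt0 ?divr_gt0.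
suff -> : polyak_rate nu L * g ^+ 2 =
    (nu / (nu + 1) * ((g / L) `^ nu^-1 * g)) `^ (2 * nu / (nu + 1)) by [].
(* Both sides are positive, so the identity of powers becomes a linear identity between
   logarithms. *)
rewrite /polyak_rate; apply: ln_inj; rewrite ?posrE.
- by rewrite !(divr_gt0, mulr_gt0, powR_gt0, exprn_gt0).
- by rewrite !(divr_gt0, mulr_gt0, powR_gt0).
rewrite !(ln_div, lnM, ln_powR, lnXn) ?posrE
  ?(divr_gt0, mulr_gt0, powR_gt0, exprn_gt0) //.
by rewrite mulr2n; field; rewrite !gt_eqF.
Qed.

End HolderSmooth.

(** * Decrease of the distance in one Polyak step *)

Section Polyak.
Variables (R : realType) (n : nat) (f : 'rV[R]_n -> R) (gamma nu L : R).
Hypothesis f_convex : convex_function setT f.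
Hypothesis f_diff : forall x, differentiable f x.
Hypothesis f_min : minimizers f !=set0.
Hypotheses (gamma_gt0 : 0 < gamma) (gamma_lt2 : gamma < 2).
Hypotheses (nu_gt0 : 0 < nu) (L_gt0 : 0 < L).
Hypothesis f_smooth : holder_smooth f nu L.
Implicit Types x xs : 'rV[R]_n.

Let A := gamma * (2 - gamma) * polyak_rate nu L.

Lemma gap_le_edot x xs : minimizers f xs ->
  f x - min_value f <= edot (grad f x) (x - xs).
Proof.
move=> fxs; rewrite (min_valueE fxs) -[x - xs]opprB edotC edotNl edotC.
have := convex_grad_le f_diff x xs f_convex.
lra.
Qed.

(** Cauchy-Schwarz in [gap_le_edot], then the infimum over the minimizers; a positive gradient norm
    can be divided out first. *)
Lemma gap_le_dist x :
  f x - min_value f <= enorm (grad f x) * dist_to x (minimizers f).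
Proof.
have [g0|g0] := eqVneq (enorm (grad f x)) 0.
  case: f_min => xs /(gap_le_edot x) /le_trans; apply.
  by rewrite (le_trans (edot_le _ _)) // g0 !mul0r.
have {}g0 : 0 < enorm (grad f x) by rewrite lt_neqAle eq_sym g0 enorm_ge0.
rewrite -ler_pdivrMl //; apply: le_dist_to => // xs fxs.
by rewrite ler_pdivrMl // (le_trans (gap_le_edot x fxs)) ?edot_le.
Qed.

(** Let [d] be the gap and [g] the gradient norm. Expanding the square, the cross term removes at
    least [2 * gamma * d ^ 2 / g ^ 2] by [gap_le_edot] and the quadratic term adds
    [gamma ^ 2 * d ^ 2 / g ^ 2]. The net decrease is bounded below by [polyak_rate_le]. *)
Lemma polyak_step_sqr x xs : minimizers f xs ->
  enorm (polyak_step f gamma x - xs) ^+ 2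
    + A * (f x - min_value f) `^ (2 / (nu + 1)) <= enorm (x - xs) ^+ 2.
Proof.
move=> fxs; rewrite /polyak_step; set d := f x - min_value f.
have nu1 : 0 < nu + 1 by rewrite addr_gt0.
have gap := gap_le_edot x fxs.
case: ifPn => [/eqP g0|g0].
  (* With a zero gradient the step does not move, so nothing may be gained: convexity forces a zero
     gap. *)
  have -> : d = 0.
    apply/eqP; rewrite eq_le subr_ge0 min_value_le // andbT.
    rewrite (le_trans gap) // (le_trans (edot_le _ _)) // g0.
    by rewrite (eqP (_ : enorm 0 == 0)) ?mul0r // enorm_eq0.
  by rewrite powR0 ?mulr0 ?addr0 // gt_eqF // divr_gt0.
have {}g0 : 0 < enorm (grad f x) by rewrite lt_neqAle eq_sym enorm_eq0 g0 enorm_ge0.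
rewrite (addrAC x) (enormB_sqr (x - xs)) enormZ edotC edotZl exprMn.
rewrite real_normK ?num_real // /polyak_stepsize -/d; set g := enorm (grad f x) in g0 *.
have := polyak_rate_le f_diff f_min nu_gt0 L_gt0 f_smooth x.
rewrite -/d -/g -ler_pdivlMr ?exprn_gt0 // => hd.
have gg : 0 <= gamma * (2 - gamma) by rewrite mulr_ge0 ?subr_ge0 ?ltW.
have h1 : 0 <= gamma * (d / g ^+ 2).
  by rewrite mulr_ge0 ?divr_ge0 ?sqr_ge0 ?subr_ge0 ?min_value_le // ltW.
have := ler_wpM2l gg hd; have := ler_wpM2l h1 gap; rewrite /A -/d.
have -> : (gamma * (d / g ^+ 2)) ^+ 2 * g ^+ 2 = gamma ^+ 2 * (d ^+ 2 / g ^+ 2).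
  by field; rewrite gt_eqF.
have -> : gamma * (d / g ^+ 2) * d = gamma * (d ^+ 2 / g ^+ 2) by ring.
lra.
Qed.

Lemma polyak_coef_ge0 : 0 <= A.
Proof.
rewrite /A pmulr_rge0 ?(ltW (polyak_rate_gt0 _ _)) //.
by rewrite mulr_gt0 ?subr_gt0.
Qed.

Lemma polyak_step_dist x :
  dist_to (polyak_step f gamma x) (minimizers f) ^+ 2
    + A * (f x - min_value f) `^ (2 / (nu + 1))
  <= dist_to x (minimizers f) ^+ 2.
Proof.
set q := A * _; set y := polyak_step f gamma x.
have q0 : 0 <= q by rewrite mulr_ge0 ?polyak_coef_ge0 ?powR_ge0.
have D0 z : 0 <= dist_to z (minimizers f) by exact: dist_to_ge0.
(* The distance is an infimum of norms, not of squares, so the left side is written as the square of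
   its root before passing to a single minimizer. *)
rewrite -[leLHS]sqr_sqrtr ?addr_ge0 ?sqr_ge0 // lerXn2r ?nnegrE ?sqrtr_ge0 //.
apply: le_dist_to => // xs fxs.
rewrite -(ger0_norm (enorm_ge0 _)) -sqrtr_sqr ler_sqrt ?sqr_ge0 //.
apply: le_trans (polyak_step_sqr x fxs); rewrite lerD2r.
by rewrite lerXn2r ?nnegrE ?enorm_ge0 ?dist_to_le.
Qed.

(** Fejér monotonicity; it keeps every iterate in [ball_union f x0], where the growth condition
    holds. *)
Lemma polyakGD_enorm x0 xs k : minimizers f xs ->
  enorm (polyakGD f gamma x0 k - xs) <= enorm (x0 - xs).
Proof.
move=> fxs; elim: k => // k; apply: le_trans.
rewrite -(@ler_pXn2r _ 2) ?nnegrE ?enorm_ge0 //.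
apply: le_trans (polyak_step_sqr _ fxs).
by rewrite lerDl mulr_ge0 ?polyak_coef_ge0 ?powR_ge0.
Qed.

Lemma polyakGD_ball_union x0 k : ball_union f x0 (polyakGD f gamma x0 k).
Proof. by case: f_min => xs fxs; exists xs => //; exact: polyakGD_enorm. Qed.

End Polyak.

(** * Real recurrences behind the two rates *)

Section Recurrences.
Variable R : realType.
Implicit Types (a : nat -> R) (q B : R).

(* With [u := B * a k `^ q], [ln (a k.+1) <= ln (a k) + ln (1 - u) <= ln (a k) - u],
   and [expR (q * u) >= 1 + q * u]. *)
Lemma powR_recurrence a q B : 0 < q -> 0 < B -> (forall k, 0 <= a k) ->
  (forall k, a k.+1 + B * a k `^ (q + 1) <= a k) ->
  forall k, a k = 0 \/ q * B * k%:R <= a k `^ (- q).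
Proof.
move=> q0 B0 a0 arec; elim=> [|k IHk]; first by right; rewrite mulr0 powR_ge0.
have [|an0] := eqVneq (a k.+1) 0; [by left | right].
have a1 : 0 < a k.+1 by rewrite lt_neqAle eq_sym an0 a0.
have ak : 0 < a k.
  apply: (lt_le_trans a1); apply: le_trans (arec k).
  by rewrite lerDl mulr_ge0 ?powR_ge0 // ltW.
case: IHk => [e|IHk]; first by rewrite e ltxx in ak.
have q1 : 0 < q + 1 by rewrite addr_gt0.
have := arec k; rewrite powRD; last by rewrite (gt_eqF q1).
rewrite powRr1 ?(ltW ak) //; set u := B * a k `^ q => h.
have {}h : a k.+1 <= a k * (1 - u).
  by apply: (@le_trans _ _ (a k - B * (a k `^ q * a k))); rewrite /u; lra.
have u1 : 0 < 1 - u by rewrite -(pmulr_rgt0 _ ak) (lt_le_trans a1).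
have lnle : ln (a k.+1) <= ln (a k) - u.
  apply: (@le_trans _ _ (ln (a k * (1 - u)))).
    by rewrite ler_ln ?posrE ?mulr_gt0.
  rewrite lnM ?posrE // lerD2l; apply: le_ln1Dx.
  by lra.
have -> : a k.+1 `^ (- q) = expR (- q * ln (a k.+1)) by rewrite /powR gt_eqF.
apply: (@le_trans _ _ (a k `^ (- q) * (1 + q * u))).
  have -> : a k `^ (- q) * (1 + q * u) = a k `^ (- q) + q * B.
    by rewrite /u powRN; field; rewrite gt_eqF ?powR_gt0.
  by rewrite -natr1; lra.
apply: (@le_trans _ _ (a k `^ (- q) * expR (q * u))).
  by rewrite ler_wpM2l ?powR_ge0 ?expR_ge1Dx.
have -> : a k `^ (- q) = expR (- q * ln (a k)) by rewrite /powR gt_eqF.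
rewrite -expRD ler_expR.
nra.
Qed.

(** From [0 <= a 1 <= (1 - q) * a 0], the ratio can be negative only if the sequence starts at 0.
    This supplies the sign needed to multiply inequalities by powers of [1 - q]. *)
Lemma linear_recurrence_ratio a q : (forall k, 0 <= a k) ->
  (forall k, a k.+1 + q * a k <= a k) -> a 0%N = 0 \/ 0 <= 1 - q.
Proof.
move=> a0 arec; have [|an0] := eqVneq (a 0%N) 0; [by left | right].
have ap : 0 < a 0%N by rewrite lt_neqAle eq_sym an0 a0.
rewrite -(pmulr_lge0 _ ap); apply: (le_trans (a0 1%N)).
by have := arec 0%N; lra.
Qed.

Lemma linear_recurrence a q : (forall k, 0 <= a k) ->
  (forall k, a k.+1 + q * a k <= a k) -> forall k, a k <= (1 - q) ^+ k * a 0%N.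
Proof.
move=> a0 arec.
have [e|q1] := linear_recurrence_ratio a0 arec; elim=> [|k IHk].
- by rewrite mul1r.
(* Here the sign of [1 - q] is unknown, but the whole sequence vanishes. *)
- have ak : a k = 0 by apply/eqP; rewrite eq_le a0 (le_trans IHk) // e mulr0.
  by have := arec k; rewrite ak e !mulr0 addr0.
- by rewrite mul1r.
- rewrite exprS -mulrA; apply: le_trans (ler_wpM2l q1 IHk).
  by have := arec k; lra.
Qed.

(** Sum the [m] decrements and drop [a (m + m)]. The window starts at [m], not at 0, so that a decay
    estimate for [a m] can be combined with the result. *)
Lemma telescope_le a (c : R) m : (forall k, 0 <= a k) ->
  (forall k, (m <= k < m + m)%N -> a k.+1 + c <= a k) -> m%:R * c <= a m.
Proof.
move=> a0 arec.
suff H j : (j <= m)%N -> j%:R * c + a (m + j)%N <= a m.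
  by apply: le_trans (H m _) => //; rewrite lerDl.
elim: j => [|j IHj] jm; first by rewrite mul0r add0r addn0.
have := IHj (ltnW jm); have := arec (m + j)%N.
rewrite leq_addr ltn_add2l jm => /(_ isT); rewrite -natr1 addnS.
lra.
Qed.

End Recurrences.

(** * Best value and the explicit sublinear constant *)

Lemma best_value_le (R : realType) (n : nat) (f : 'rV[R]_n -> R)
    (x : nat -> 'rV[R]_n) (K k : nat) :
  (1 <= k <= K)%N -> best_value f x K <= f (x k).
Proof.
by move=> kK; apply: ge_bigmin_seq => //; rewrite mem_index_iota.
Qed.

Lemma le_best_value (R : realType) (n : nat) (f : 'rV[R]_n -> R)
    (x : nat -> 'rV[R]_n) (K : nat) (a : R) :
  (forall k, a <= f (x k)) -> a <= best_value f x K.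
Proof. by move=> af; apply: le_bigmin. Qed.

(* The two hypotheses are linear in the logarithms, and so is the conclusion. *)
Lemma polyak_sublinear_bound (R : realType) (G nu L r rho M a m : R) :
  0 < G -> 0 < nu -> 0 < L -> 0 < rho -> nu + 1 < r -> 0 < M -> 0 < m -> 0 < a ->
  m * (G * polyak_rate nu L * M `^ (2 / (nu + 1))) <= a ->
  (r / (nu + 1) - 1) * (G * polyak_rate nu L * rho `^ (2 / (nu + 1))) * m
    <= a `^ (- (r / (nu + 1) - 1)) ->
  M <= ((r - nu - 1) `^ ((nu + 1) ^+ 2 / (2 * (nu + 1 - r)))
        * G `^ (r * (nu + 1) / (2 * (nu + 1 - r)))
        * nu `^ (nu * r / (nu + 1 - r)))
       / (2 `^ (r * (nu + 1) / (2 * (nu + 1 - r)))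
          * (nu + 1) `^ (((nu + 1) ^+ 2 + 2 * nu * r) / (2 * (nu + 1 - r))))
       * (L `^ (r / (r - nu - 1))
          / (rho `^ ((nu + 1) / (r - nu - 1))
             * (2 * m) `^ (r * (nu + 1) / (2 * (r - nu - 1))))).
Proof.
move=> G0 nu0 L0 rho0 nur M0 m0 a0.
have N0 : 0 < nu + 1 by rewrite addr_gt0.
have s0 : 0 < r - nu - 1 by lra.
have -> : r / (nu + 1) - 1 = (r - nu - 1) / (nu + 1).
  by field; rewrite gt_eqF.
have gt0E := (divr_gt0, mulr_gt0, powR_gt0).
have lnE := (ln_div, lnM, ln_powR).
rewrite /polyak_rate -ler_ln ?posrE ?gt0E // !lnE ?posrE ?gt0E // => h1.
rewrite -ler_ln ?posrE ?gt0E // !lnE ?posrE ?gt0E // => h2.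
rewrite -ler_ln ?posrE ?gt0E // !lnE ?posrE ?gt0E //.
(* Weights of the two hypotheses: [c1] gives [ln M] coefficient 1, and [c2] is chosen so that [ln a]
   cancels in the weighted sum. *)
have c1 : 0 <= (nu + 1) / 2 by rewrite ltW ?divr_gt0.
have c2 : 0 <= (nu + 1) ^+ 2 / (2 * (r - nu - 1)).
  by rewrite ltW ?divr_gt0 ?mulr_gt0 ?exprn_gt0.
move: h1 h2; rewrite -subr_ge0 => /(mulr_ge0 c1) h1.
rewrite -subr_ge0 => /(mulr_ge0 c2) /(addr_ge0 h1) h.
rewrite -subr_ge0; apply: (le_trans h).
(* No slack is left: the weighted sum equals the difference of the logarithms of the two sides. *)
rewrite le_eqVlt; apply/orP; left; apply/eqP; field.
by rewrite (gt_eqF s0) (gt_eqF N0) lt_eqF // subr_lt0.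
Qed.

(** * Linear and sublinear rates of the iterates *)

Section PolyakRates.
Variables (R : realType) (n : nat) (f : 'rV[R]_n -> R).
Variables (gamma nu L r rho : R) (x0 : 'rV[R]_n).
Hypothesis f_convex : convex_function setT f.
Hypothesis f_diff : forall x, differentiable f x.
Hypothesis f_min : minimizers f !=set0.
Hypotheses (gamma_gt0 : 0 < gamma) (gamma_lt2 : gamma < 2).
Hypotheses (nu_gt0 : 0 < nu) (L_gt0 : 0 < L).
Hypothesis rho_gt0 : 0 < rho.
Hypothesis f_smooth : holder_smooth f nu L.
Hypothesis f_growth : holder_growth f r rho (ball_union f x0).

Let x := polyakGD f gamma x0.
Let dsq (k : nat) : R := dist_to (x k) (minimizers f) ^+ 2.
Let A := gamma * (2 - gamma) * polyak_rate nu L.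

Let A_gt0 : 0 < A.
Proof.
by apply: mulr_gt0 (polyak_rate_gt0 nu_gt0 L_gt0); rewrite mulr_gt0 ?subr_gt0.
Qed.

Let x_ball_union k : ball_union f x0 (x k).
Proof.
exact: (polyakGD_ball_union f_convex f_diff f_min gamma_gt0 gamma_lt2
  nu_gt0 L_gt0 f_smooth).
Qed.

Let dsq_ge0 k : 0 <= dsq k. Proof. exact: sqr_ge0. Qed.

Let dsq_decrease k :
  dsq k.+1 + A * (f (x k) - min_value f) `^ (2 / (nu + 1)) <= dsq k.
Proof. exact: polyak_step_dist. Qed.

(** The growth condition at [x k], raised to the power [2 / (nu + 1)], replaces the gap in
    [dsq_decrease] by a power of the squared distance. *)
Let dsq_recurrence k :
  dsq k.+1 + A * rho `^ (2 / (nu + 1)) * dsq k `^ (r / (nu + 1)) <= dsq k.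
Proof.
apply: le_trans (dsq_decrease k); rewrite lerD2l -mulrA ler_pM2l //.
have D0 : 0 <= dist_to (x k) (minimizers f) by exact: dist_to_ge0.
have e0 : 0 <= 2 / (nu + 1) by rewrite divr_ge0 ?addr_ge0 // ltW.
have -> : dsq k `^ (r / (nu + 1)) =
    (dist_to (x k) (minimizers f) `^ r) `^ (2 / (nu + 1)).
  rewrite /dsq -powR_mulrn // -!powRrM; congr (_ `^ _).
  by rewrite mulrCA mulrA.
rewrite -powRM ?powR_ge0 ?(ltW rho_gt0) //.
apply: ge0_ler_powR => //; rewrite ?nnegrE ?mulr_ge0 ?powR_ge0 ?(ltW rho_gt0) //.
  by rewrite subr_ge0 min_value_le.
by apply: f_growth; exact: x_ball_union.
Qed.

Lemma polyak_linear_rate K : r = nu + 1 -> ~~ odd K ->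
  ((f (x K) - min_value f)%:E
   <= ((1 - A * rho `^ (2 / (nu + 1))) ^+ K./2)%:E
      * grad_sup f (ball_union f x0) * (dist_to x0 (minimizers f))%:E)%E.
Proof.
move=> rE K_even; set q := A * _; set D0 := dist_to x0 _.
have D0_ge0 : 0 <= D0 by exact: dist_to_ge0.
have nu1 : nu + 1 != 0 by rewrite gt_eqF // addr_gt0.
have rec k : dsq k.+1 + q * dsq k <= dsq k.
  by have := dsq_recurrence k; rewrite rE divff // powRr1 ?dsq_ge0.
have distK : dist_to (x K) (minimizers f) <= (1 - q) ^+ K./2 * D0.
  have DK0 : 0 <= dist_to (x K) (minimizers f) by exact: dist_to_ge0.
  have := linear_recurrence dsq_ge0 rec K.
  (* Since [K] is even, [(1 - q) ^+ K] is the square of [(1 - q) ^+ K./2], so a root of the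
     recurrence bound needs no real power. *)
  rewrite -[in X in X * _](odd_double_half K) (negbTE K_even) add0n -muln2 exprM.
  rewrite /dsq -exprMn -/x -/D0 ler_pXn2r ?nnegrE //.
  have [/eqP|q1] := linear_recurrence_ratio dsq_ge0 rec.
    by rewrite /dsq sqrf_eq0 -/D0 => /eqP ->; rewrite mulr0.
  by rewrite mulr_ge0 ?exprn_ge0.
have gapK := gap_le_dist f_convex f_diff f_min (x K).
have [/eqP|q1] := linear_recurrence_ratio dsq_ge0 rec.
  (* In the extended reals the right side is 0 here even if [grad_sup] is infinite, so the gap
     itself must be shown to be at most 0. *)
  rewrite /dsq sqrf_eq0 -/D0 => /eqP D00; rewrite D00 mule0 lee_fin.
  apply: (le_trans gapK); rewrite mulr_ge0_le0 ?enorm_ge0 //.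
  by rewrite (le_trans distK) // D00 mulr0.
apply: (@le_trans _ _ ((1 - q) ^+ K./2 * enorm (grad f (x K)) * D0)%:E).
  rewrite lee_fin (le_trans gapK) // mulrAC [leRHS]mulrC.
  by rewrite ler_wpM2l ?enorm_ge0.
rewrite !EFinM lee_wpmul2r ?lee_fin // lee_wpmul2l ?lee_fin ?exprn_ge0 //.
by apply: ereal_sup_ubound; exists (x K).
Qed.

(** Provides the inputs of [polyak_sublinear_bound]: telescoping from [m] to [m + m] with each gap
    at least [M], and [powR_recurrence] at [m]. The case [M = 0] is split off because logarithms are
    taken there. *)
Lemma polyak_sublinear_rate m : nu + 1 < r -> (0 < m)%N ->
  let M := best_value f x (m + m) - min_value f in
  M = 0 \/ [/\ 0 < M, 0 < dsq m,
    m%:R * (A * M `^ (2 / (nu + 1))) <= dsq m &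
    (r / (nu + 1) - 1) * (A * rho `^ (2 / (nu + 1))) * m%:R
      <= dsq m `^ (- (r / (nu + 1) - 1))].
Proof.
move=> nur m0 M.
have nu1 : 0 < nu + 1 by rewrite addr_gt0.
have M0 : 0 <= M by rewrite subr_ge0 le_best_value // => k; exact: min_value_le.
have [|Mn0] := eqVneq M 0; [by left | right].
have Mp : 0 < M by rewrite lt_neqAle eq_sym Mn0.
have tele : m%:R * (A * M `^ (2 / (nu + 1))) <= dsq m.
  apply: telescope_le => [|k /andP[mk km]]; first exact: dsq_ge0.
  apply: le_trans (dsq_decrease k); rewrite lerD2l ler_pM2l //.
  apply: ge0_ler_powR; rewrite ?nnegrE ?M0 ?subr_ge0 ?min_value_le //.
    by rewrite divr_ge0 ?(ltW nu1).
  (* The best value starts at index 1, so [0 < m] is what admits every [k] of the window. *)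
  by rewrite /M lerD2r best_value_le // (leq_trans m0 mk) ltnW.
have dm : 0 < dsq m.
  by apply: lt_le_trans tele; rewrite pmulr_rgt0 ?ltr0n // pmulr_rgt0 // powR_gt0.
split => //.
have q0 : 0 < r / (nu + 1) - 1 by rewrite subr_gt0 ltr_pdivlMr // mul1r.
have B0 : 0 < A * rho `^ (2 / (nu + 1)) by rewrite mulr_gt0 ?powR_gt0.
have [|e|//] := powR_recurrence q0 B0 dsq_ge0 _ m.
  by move=> k; rewrite subrK; exact: dsq_recurrence.
by rewrite e ltxx in dm.
Qed.

End PolyakRates.

Theorem theorem4p1 (R : realType) (n : nat) (f : 'rV[R]_n -> R)
  (gamma nu L r rho : R) (x0 : 'rV[R]_n)
  (f_convex : convex_function setT f)
  (f_diff : forall x, differentiable f x)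
  (f_min : minimizers f !=set0)
  (gamma_gt0 : 0 < gamma) (gamma_lt2 : gamma < 2)
  (nu_gt0 : 0 < nu) (nu_le1 : nu <= 1) (L_gt0 : 0 < L)
  (r_ge1 : 1 <= r) (rho_gt0 : 0 < rho)
  (f_smooth : holder_smooth f nu L)
  (f_growth : holder_growth f r rho (ball_union f x0))
  (K : nat) (K_ge1 : (1 <= K)%N) (K_even : ~~ odd K) :
  (r = nu + 1 ->
    ((best_value f (polyakGD f gamma x0) K - min_value f)%:E
     <= ((1 - gamma * (2 - gamma) * nu `^ (2 * nu / (nu + 1))
                * rho `^ (2 / (nu + 1))
              / ((nu + 1) `^ (2 * nu / (nu + 1)) * L `^ (2 / (nu + 1))))
         ^+ (K./2))%:E
        * grad_sup f (ball_union f x0) * (dist_to x0 (minimizers f))%:E)%E)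
  /\
  (nu + 1 < r ->
    best_value f (polyakGD f gamma x0) K - min_value f
    <= ((r - nu - 1) `^ ((nu + 1) ^+ 2 / (2 * (nu + 1 - r)))
        * (gamma * (2 - gamma)) `^ (r * (nu + 1) / (2 * (nu + 1 - r)))
        * nu `^ (nu * r / (nu + 1 - r)))
       / (2 `^ (r * (nu + 1) / (2 * (nu + 1 - r)))
          * (nu + 1) `^ (((nu + 1) ^+ 2 + 2 * nu * r) / (2 * (nu + 1 - r))))
       * (L `^ (r / (r - nu - 1))
          / (rho `^ ((nu + 1) / (r - nu - 1))
             * K%:R `^ (r * (nu + 1) / (2 * (r - nu - 1)))))).
Proof.
split => [rE|nur].
  set c := (X in (1 - X) ^+ _).
  have -> : c = gamma * (2 - gamma) * polyak_rate nu L * rho `^ (2 / (nu + 1)).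
    by rewrite /c /polyak_rate !mulrA [LHS]mulrAC.
  apply: le_trans (polyak_linear_rate f_convex f_diff f_min gamma_gt0 gamma_lt2
    nu_gt0 L_gt0 rho_gt0 f_smooth f_growth rE K_even).
  (* The last iterate already meets the linear bound. *)
  by rewrite lee_fin lerD2r best_value_le // K_ge1 leqnn.
have -> : K%:R = 2 * K./2%:R :> R.
  by rewrite -{1}(odd_double_half K) (negbTE K_even) add0n -mul2n natrM.
have m0 : (0 < K./2)%N by move: K K_ge1 K_even => [|[|k]].
have := polyak_sublinear_rate f_convex f_diff f_min gamma_gt0 gamma_lt2 nu_gt0
  L_gt0 rho_gt0 f_smooth f_growth nur m0.
rewrite addnn; have -> : K./2.*2 = K.
  by rewrite -[RHS]odd_double_half (negbTE K_even).
case=> [->|[M0 d0 h1 h2]].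
  (* If the best gap is 0, nonnegativity of the right side suffices. *)
  by rewrite !(mulr_ge0, invr_ge0, powR_ge0).
apply: polyak_sublinear_bound M0 _ d0 h1 h2 => //; last by rewrite ltr0n.
by rewrite mulr_gt0 ?subr_gt0.
Qed.
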